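(* Let $\theta_1,\dots,\theta_k\in\Theta$ and $y_1,\dots,y_k\in\Lambda$ be given, let $\Gamma\subset C^\infty(\Theta,\Lambda)$ be a compact finite-dimensional submanifold, and let $$\mathsf{s}(\gamma)=\frac1k\sum_{l=1}^k|\jmath(y_l)-\jmath(\gamma(\theta_l))|^2 .$$ The first-order condition for $\gamma\in\Gamma$ to be a minimizer of $\mathsf{s}$ over $\Gamma$ is that $\mathrm{d}_\gamma\mathsf{s}\in \mathrm{N}_\gamma\Gamma\subset T^*_\gamma C^\infty(\Theta,\Lambda)$. That is, if $\gamma\in\Gamma$ minimizes $\mathsf{s}$ over $\Gamma$, then $$\left.\sum_{i=1}^k\bigl(\mathrm{d}_{\lambda_i}\jmath\cdot\mathrm{d}_\gamma \mathrm{ev}_i\bigr)^*\cdot\bigl(\jmath(y_i)-\jmath\,\mathrm{ev}_i(\gamma)\bigr)\right|_{T_\gamma\Gamma}=0,\qquad\text{where }\lambda_i=\gamma(\theta_i).$$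
   Context: $\Theta$ and $\Lambda$ are smooth manifolds; $(\Lambda,\mathbf{h})$ is a Riemannian manifold isometrically embedded in a euclidean space $(\mathbf{E},\sigma)$ by $\jmath:\Lambda\to\mathbf{E}$, with norm $|\cdot|$ on $\mathbf{E}$. $C^\infty(\Theta,\Lambda)$ is regarded as a Fréchet manifold; a tangent vector $v\in T_\gamma C^\infty(\Theta,\Lambda)$ is a smooth section of $\gamma^*T\Lambda$, i.e. a smooth map $v:\Theta\to T\Lambda$ with $v(\theta)\in T_{\gamma(\theta)}\Lambda$. The evaluation maps $\mathrm{ev}_i:\Gamma\to\Lambda$ are $\mathrm{ev}_i(\gamma)=\gamma(\theta_i)$, so $\mathrm{d}_\gamma\mathrm{ev}_i\cdot v=v(\theta_i)$ for $v\in T_\gamma \Gamma$. $\mathrm{N}_\gamma\Gamma$ denotes the annihilator of $T_\gamma\Gamma$ in $T_\gamma^*C^\infty(\Theta,\Lambda)$. The star denotes the adjoint (transpose) map, with $T_\bullet\mathbf{E}$ and $T_\bullet^*\mathbf{E}$ identified by the euclidean structure; the displayed equation means that $\sum_i\langle \jmath(y_i)-\jmath\,\mathrm{ev}_i(\gamma),\mathrm{d}_{\lambda_i}\jmath\cdot\mathrm{d}_\gamma\mathrm{ev}_i\cdot v\rangle=0$ for all $v\in T_\gamma\Gamma$. *)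

(* Defs.v *)
From HB Require Import structures.
From mathcomp Require Import all_boot all_order all_algebra.
From mathcomp Require Import all_classical all_reals all_analysis.

Set Implicit Arguments.
Unset Strict Implicit.
Unset Printing Implicit Defensive.

Import Order.TTheory GRing.Theory Num.Theory numFieldNormedType.Exports.

Local Open Scope classical_set_scope.
Local Open Scope ring_scope.

(* Meant for an open set A and finite-dimensional V, where being C^(k+1) means
   being differentiable with all directional derivatives of class C^k. *)
Fixpoint Ck (R : realType) (V W : normedModType R) (k : nat) (A : set V)
    (f : V -> W) : Prop :=
  if k is k'.+1 then
    (forall x, A x -> differentiable f x) /\
    (forall v : V, Ck k' A (fun x => 'D_v f x : W))
  else forall x, A x -> {for x, continuous f}.

Definition smooth_on (R : realType) (V W : normedModType R) (A : set V)
  (f : V -> W) : Prop := forall k, Ck k A f.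

Definition iter_derive (R : realType) (V W : normedModType R) (vs : seq V)
    (f : V -> W) : V -> W :=
  foldr (fun v (g : V -> W) => (fun x => 'D_v g x : W)) f vs.

(* [chart_inv] is only meaningful on [chart_cod]. *)
Record chart (R : realType) (M : topologicalType) (n : nat) := Chart {
  chart_dom : set M;
  chart_map :> M -> 'rV[R]_n;
  chart_inv : 'rV[R]_n -> M;
  chart_dom_open : open chart_dom;
  chart_cod_open : open (chart_map @` chart_dom);
  chart_map_continuous : {within chart_dom, continuous chart_map};
  chart_inv_continuous :
    {within chart_map @` chart_dom, continuous chart_inv};
  chart_mapK : forall x, chart_dom x -> chart_inv (chart_map x) = x }.

Definition chart_cod (R : realType) (M : topologicalType) (n : nat)
  (c : chart R M n) : set 'rV[R]_n := c @` chart_dom c.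

(* The atlas is not required to be maximal: every notion below is independent
   of the atlas chosen to represent a given smooth structure. *)
Record manifold (R : realType) := Manifold {
  carrier :> topologicalType;
  dim : nat;
  atlas : set (chart R carrier dim);
  manifold_hausdorff : hausdorff_space carrier;
  manifold_second_countable : @second_countable carrier;
  atlas_cover : forall x, exists c, atlas c /\ chart_dom c x;
  atlas_compatible : forall c d, atlas c -> atlas d ->
    smooth_on (c @` (chart_dom c `&` chart_dom d))
      (chart_map d \o chart_inv c) }.

Definition charts_at (R : realType) (M : manifold R) (x : M) :
  set (chart R M (dim M)) := [set c | atlas c /\ chart_dom c x].

Section Tangent.
Variables (R : realType) (M : manifold R) (x : M).

(* A tangent vector at x is the family of its coordinates in the charts of the
   atlas around x, subject to the usual transformation rule; the coordinates
   in the other charts are set to 0 so that equality is the expected one. *)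
Definition is_tangent (xi : chart R M (dim M) -> 'rV[R]_(dim M)) : Prop :=
  (forall c, ~ charts_at x c -> xi c = 0) /\
  (forall c d, charts_at x c -> charts_at x d ->
    xi d = 'd (chart_map d \o chart_inv c) (chart_map c x) (xi c)).

Definition tangent_pred : {pred chart R M (dim M) -> 'rV[R]_(dim M)} :=
  fun xi => `[< is_tangent xi >].

Fact tangent_submod_closed : submod_closed tangent_pred.
Proof.
split; first by apply/asboolP; split=> [c _|c d _ _]; rewrite ?linear0.
move=> a xi eta /asboolP[xi0 xiE] /asboolP[eta0 etaE].
apply/asboolP; split=> [c xc|c d xc xd].
  by rewrite !fctE xi0 // eta0 // scaler0 addr0.
by rewrite !fctE linearP -xiE // -etaE.
Qed.

HB.instance Definition _ := GRing.isSubmodClosed.Build R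
  (chart R M (dim M) -> 'rV[R]_(dim M)) tangent_pred tangent_submod_closed.

Record tangent := Tangent {
  tangent_coord : chart R M (dim M) -> 'rV[R]_(dim M);
  _ : tangent_coord \in tangent_pred }.

HB.instance Definition _ := [isSub for tangent_coord].
HB.instance Definition _ := [Choice of tangent by <:].
HB.instance Definition _ := [SubChoice_isSubLmodule of tangent by <:].

End Tangent.

Definition smooth_vec (R : realType) (M : manifold R) (W : normedModType R)
    (f : M -> W) : Prop :=
  forall c, atlas c -> smooth_on (chart_cod c) (f \o chart_inv c).

(* The chart used is irrelevant when f is differentiable at x. *)
Definition tangent_map (R : realType) (M : manifold R) (W : normedModType R)
    (f : M -> W) (x : M) (xi : tangent x) : W :=
  let c := sval (cid (atlas_cover x)) in
  'd (f \o chart_inv c) (chart_map c x) (tangent_coord xi c).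

Record riemannian_metric (R : realType) (M : manifold R) := RiemannianMetric {
  metric :> forall x : M, tangent x -> tangent x -> R;
  metric_linear : forall (x : M) (xi : tangent x), scalar (metric xi);
  metric_sym : forall (x : M) (xi eta : tangent x),
    metric xi eta = metric eta xi;
  metric_pos : forall (x : M) (xi : tangent x), xi != 0 -> 0 < metric xi xi;
  metric_smooth : forall c : chart R M (dim M), atlas c ->
    exists2 g : 'rV[R]_(dim M) -> 'M[R]_(dim M), smooth_on (chart_cod c) g &
      forall x, chart_dom c x -> forall xi eta : tangent x,
        metric xi eta =
        (tangent_coord xi c *m g (c x) *m (tangent_coord eta c)^T) 0 0 }.

(* sigma is an inner product inducing the norm of E. *)
Record euclidean (R : realType) (E : normedModType R) (sigma : E -> E -> R) :
    Prop := Euclidean {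
  euclidean_linear : forall u : E, scalar (sigma u);
  euclidean_sym : forall u v : E, sigma u v = sigma v u;
  euclidean_norm : forall u : E, `|u| ^+ 2 = sigma u u;
  euclidean_findim : exists (n : nat) (b : 'I_n -> E), forall u : E,
    exists a : 'I_n -> R, u = \sum_(i < n) a i *: b i }.

Record isometric_embedding (R : realType) (M : manifold R)
    (h : riemannian_metric M) (E : normedModType R) (sigma : E -> E -> R)
    (j : M -> E) : Prop := IsometricEmbedding {
  embedding_smooth : smooth_vec j;
  embedding_inj : injective j;
  embedding_open : forall U : set M, open U ->
    exists2 O : set E, open O & j @` U = range j `&` O;
  embedding_isometry : forall (x : M) (xi eta : tangent x),
    sigma (tangent_map j xi) (tangent_map j eta) = h x xi eta }.

Definition smooth_between (R : realType) (M N : manifold R) (f : M -> N) :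
    Prop :=
  continuous f /\
  forall c d, atlas c -> atlas d ->
    smooth_on (c @` (chart_dom c `&` f @^-1` chart_dom d))
      (chart_map d \o f \o chart_inv c).

Record smooth_map (R : realType) (M N : manifold R) := SmoothMap {
  smooth_fun :> M -> N;
  smooth_funP : smooth_between smooth_fun }.

HB.instance Definition _ (R : realType) (M N : manifold R) :=
  gen_eqMixin (smooth_map M N).
HB.instance Definition _ (R : realType) (M N : manifold R) :=
  gen_choiceMixin (smooth_map M N).

(* The C^oo compact-open topology: g is close to f when, in charts and over a
   compact set K, an iterated derivative of g is uniformly close to that of
   f. *)
Definition Coo_subbase (R : realType) (M N : manifold R) :
    set (set (smooth_map M N)) :=
  [set B | exists (f : smooth_map M N) (c : chart R M (dim M))
      (d : chart R N (dim N)) (K : set M) (vs : seq 'rV[R]_(dim M)) (e : R),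
    [/\ [/\ atlas c, atlas d & 0 < e],
        [/\ compact K, K `<=` chart_dom c & f @` K `<=` chart_dom d] &
        B = [set g : smooth_map M N | g @` K `<=` chart_dom d /\
          forall x, K x ->
            `| iter_derive vs (chart_map d \o g \o chart_inv c) (c x)
             - iter_derive vs (chart_map d \o f \o chart_inv c) (c x) | < e]]].

HB.instance Definition _ (R : realType) (M N : manifold R) :=
  isSubBaseTopological.Build (smooth_map M N) (@Coo_subbase R M N) id.

Section MapSpace.
Variables (R : realType) (M N : manifold R).

(* A map from an open subset A of a finite-dimensional space V into the
   manifold of maps C^oo(M,N) is smooth iff its adjoint A x M -> N is smooth
   (exponential law). *)
Record smooth_family (V : normedModType R) (A : set V)
    (phi : V -> smooth_map M N) : Prop := SmoothFamily {
  family_continuous :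
    {within A `*` [set: M], continuous (fun p : V * M => phi p.1 p.2)};
  family_smooth : forall c d, atlas c -> atlas d ->
    smooth_on
      [set p : V * 'rV[R]_(dim M) | [/\ A p.1, chart_cod c p.2 &
         chart_dom d (phi p.1 (chart_inv c p.2))]]
      (fun p => chart_map d (phi p.1 (chart_inv c p.2))) }.

Definition section_along (gamma : M -> N) := forall t : M, tangent (gamma t).

(* Smoothness as a map from M to the tangent bundle of N, in bundle charts. *)
Definition smooth_section (gamma : M -> N) (v : section_along gamma) : Prop :=
  forall c d, atlas c -> atlas d ->
    smooth_on (c @` (chart_dom c `&` gamma @^-1` chart_dom d))
      (fun z => tangent_coord (v (chart_inv c z)) d).

Definition map_tangent (gamma : smooth_map M N) : set (section_along gamma) :=
  [set v | smooth_section v].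

(* v is the image of u under the differential at w of phi, where
   phi w = gamma: its value at t is the velocity of z |-> phi z t. *)
Definition velocity (V : normedModType R) (phi : V -> smooth_map M N)
    (w u : V) (gamma : smooth_map M N) (v : section_along gamma) : Prop :=
  forall (t : M) d, charts_at (gamma t) d ->
    is_derive w u (fun z => chart_map d (phi z t)) (tangent_coord (v t) d).

(* Continuous linear functionals on T_gamma C^oo(M,N); continuity is stated
   with the seminorms defining the C^oo topology on sections.  Values outside
   map_tangent are irrelevant. *)
Record map_cotangent (gamma : smooth_map M N) (l : section_along gamma -> R) :
    Prop := MapCotangent {
  cotangent_linear : forall (a : R) (v w : section_along gamma),
    map_tangent v -> map_tangent w ->
    l (fun t => a *: v t + w t) = a * l v + l w;
  cotangent_continuous : exists (n : nat) (c : 'I_n -> chart R M (dim M))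
      (d : 'I_n -> chart R N (dim N)) (K : 'I_n -> set M)
      (vs : 'I_n -> seq 'rV[R]_(dim M)) (C : R),
    (forall i, [/\ atlas (c i), atlas (d i), compact (K i),
       K i `<=` chart_dom (c i) & gamma @` K i `<=` chart_dom (d i)]) /\
    (forall v, map_tangent v -> forall B : R, 0 <= B ->
       (forall i x, K i x ->
          `| iter_derive (vs i)
               (fun z => tangent_coord (v (chart_inv (c i) z)) (d i))
               (c i x) | <= B) ->
       `| l v | <= C * B) }.

Record is_differential (F : smooth_map M N -> R) (gamma : smooth_map M N)
    (l : section_along gamma -> R) : Prop := IsDifferential {
  differential_cotangent : map_cotangent l;
  differential_derive : forall (p : nat) (A : set 'rV[R]_p)
      (phi : 'rV[R]_p -> smooth_map M N) (w u : 'rV[R]_p) v,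
    open A -> smooth_family A phi -> A w -> phi w = gamma ->
    map_tangent v -> velocity phi w u v ->
    is_derive w u (F \o phi) (l v) }.

Record local_parametrization (p : nat) (Gamma : set (smooth_map M N))
    (A : set 'rV[R]_p) (phi : 'rV[R]_p -> smooth_map M N) : Prop :=
    LocalParametrization {
  param_open : open A;
  param_smooth : smooth_family A phi;
  param_continuous : {within A, continuous phi};
  param_inj : forall w w', A w -> A w' -> phi w = phi w' -> w = w';
  param_immersion : forall w u, A w ->
    velocity phi w u (gamma := phi w) (fun=> 0) -> u = 0;
  param_image_open : forall B : set 'rV[R]_p, open B -> B `<=` A ->
    exists2 O : set (smooth_map M N), open O & phi @` B = Gamma `&` O }.

Definition submanifold (p : nat) (Gamma : set (smooth_map M N)) : Prop :=
  forall gamma, Gamma gamma -> exists A phi,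
    @local_parametrization p Gamma A phi /\ (phi @` A) gamma.

Definition submanifold_tangent (p : nat) (Gamma : set (smooth_map M N))
    (gamma : smooth_map M N) : set (section_along gamma) :=
  [set v | map_tangent v /\ exists A phi w u,
    [/\ @local_parametrization p Gamma A phi, A w, phi w = gamma &
        velocity phi w u v]].

Definition submanifold_conormal (p : nat) (Gamma : set (smooth_map M N))
    (gamma : smooth_map M N) : set (section_along gamma -> R) :=
  [set l | map_cotangent l /\
    forall v, submanifold_tangent p Gamma v -> l v = 0].

Definition eval_map (t : M) (gamma : smooth_map M N) : N := gamma t.

Definition eval_tangent (t : M) (gamma : smooth_map M N)
  (v : section_along gamma) : tangent (eval_map t gamma) := v t.

End MapSpace.

(* The transpose of a linear map L into E, applied to e : E, where E is
   identified with its dual through sigma. *)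
Definition transpose (R : realType) (E : normedModType R) (sigma : E -> E -> R)
  (T : Type) (L : T -> E) (e : E) : T -> R := fun v => sigma e (L v).

Definition least_squares (R : realType) (M N : manifold R)
    (E : normedModType R) (j : N -> E) (k : nat) (theta : 'I_k -> M)
    (y : 'I_k -> N) (gamma : smooth_map M N) : R :=
  k%:R^-1 * \sum_(l < k) `| j (y l) - j (gamma (theta l)) | ^+ 2.

(* Main.v *)
Require Import Defs.
From mathcomp Require Import all_boot all_order all_algebra.
From mathcomp Require Import all_classical all_reals all_analysis.
From mathcomp Require Import ring lra.
Import Order.TTheory GRing.Theory Num.Theory numFieldNormedType.Exports.

Local Open Scope classical_set_scope.
Local Open Scope ring_scope.

(** The functional s depends on a map g only through the finitely many values
g(theta_i), hence it behaves like a smooth function of finitely many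
variables. Along a smooth finite-dimensional family phi with phi(w) = gamma
and velocity v at w in the direction u, each value phi(z)(theta_i) stays near
z = w in a chart around gamma(theta_i), by joint continuity of the family, and
has velocity v(theta_i) there. The chain rule
([is_derive_smooth_family_eval]) and the derivative of the squared euclidean
norm ([is_derive_sqr_norm]) then give the derivative of s along phi, namely
-(2/k) sum_i <j(y_i) - j(gamma(theta_i)), dj (v(theta_i))>. As a function of v
this is a continuous covector for the C^oo topology, because it is bounded by
the values of v at the theta_i; so it is a differential of s at gamma
([least_squares_is_differential]).

On the other hand any differential l of a functional F at a minimizer gamma
over Gamma is conormal to Gamma ([is_differential_conormal]): a tangent vector
v of Gamma is the velocity at some w of a local parametrization phi of Gamma,
the function F o phi has a local minimum at w, and its derivative there is
l(v), which vanishes by Fermat's theorem ([is_derive_local_min]). Applied to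
the explicit differential of s, this makes the sum of the residuals vanish on
the tangent space of Gamma, since 2/k is nonzero. *)

(** * Derivatives in a fixed direction *)

Lemma is_derive_cvg {R : realType} {V W : normedModType R} {f : V -> W}
    {a v : V} {df : W} :
  (fun h : R => h^-1 *: (f (h *: v + a) - f a)) @ 0^' --> df ->
  is_derive a v f df.
Proof.
move=> fdf; apply: DeriveDef; first by apply/cvg_ex; exists df.
exact: cvg_lim.
Qed.

Lemma is_derive_quotient {R : realType} {V W : normedModType R} {f : V -> W}
    {a v : V} {df : W} :
  is_derive a v f df ->
  (fun h : R => h^-1 *: (f (h *: v + a) - f a)) @ 0^' --> df.
Proof. by case=> fav <-. Qed.

(** Only the outer function has to be differentiable: the derivative of the
inner one in the direction [v] is that of its restriction to a line, and on
the real line derivability and differentiability agree. This matters because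
velocities of families of maps are known one direction at a time. *)
Lemma is_derive_diff_comp {R : realType} {U V W : normedModType R}
    {f : U -> V} {g : V -> W} {a v : U} {df : V} :
  is_derive a v f df -> differentiable g (f a) ->
  is_derive a v (g \o f) ('d g (f a) df).
Proof.
move=> fdf dg.
pose line (h : R) := f (h *: v + a).
have line0 : line 0 = f a by rewrite /line scale0r add0r.
have dline : differentiable line 0.
  by apply/derivable1_diffP; apply: (derivable1P f a v).1; case: fdf.
have line_df : 'd line 0 1 = df.
  rewrite -deriveE //; apply: derive_val; apply: is_derive_cvg.
  apply: cvg_trans (is_derive_quotient fdf); apply: near_eq_cvg.
  by apply: nearW => h /=; rewrite addr0 line0 [h *: 1]mulr1.
have dgl : differentiable g (line 0) by rewrite line0.
have dgline := differentiable_comp dline dgl.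
have : is_derive (0 : R) 1 (g \o line) ('d g (f a) df).
  apply: DeriveDef; first exact: diff_derivable.
  by rewrite deriveE // diff_comp //= line0 line_df.
move=> /is_derive_quotient gdf; apply: is_derive_cvg.
apply: cvg_trans gdf; apply: near_eq_cvg; apply: nearW => h /=.
by rewrite addr0 line0 [h *: 1]mulr1.
Qed.

(** Fermat's theorem. The difference quotients at [h > 0] are nonnegative and
those at [h < 0] nonpositive, so one-sided limits suffice and [f] need only be
derivable at [a] itself. *)
Lemma is_derive_local_min {R : realType} {V : normedModType R} {f : V -> R}
    {a v : V} {df : R} :
  is_derive a v f df -> (\forall x \near a, f a <= f x) -> df = 0.
Proof.
move=> /is_derive_quotient fdf fmin.
have line_min : \forall h \near (0 : R), f a <= f (h *: v + a).
  have line_cont : (fun h : R => h *: v + a) @ 0 --> a.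
    rewrite -[X in _ --> X]add0r; apply: cvgD; last exact: cvg_cst.
    by rewrite -[X in _ --> X](scale0r v); apply: scalel_continuous.
  exact: line_cont fmin.
apply/eqP; rewrite eq_le; apply/andP; split.
- apply: (cvgr_to_le (cvg_dnbhs_at_left fdf)).
  near=> h; apply: mulr_le0_ge0.
    by rewrite invr_le0; apply: ltW; near: h; exists 1 => /=.
  by rewrite subr_ge0; near: h; exact: cvg_within line_min.
- apply: (cvgr_to_ge (cvg_dnbhs_at_right fdf)).
  near=> h; apply: mulr_ge0.
    by rewrite invr_ge0; apply: ltW; near: h; exists 1 => /=.
  by rewrite subr_ge0; near: h; exact: cvg_within line_min.
Unshelve. all: by end_near. Qed.

(** * Inner products *)

Section Euclidean.
Context {R : realType} {E : normedModType R} {sigma : E -> E -> R}.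
Hypothesis E_euclidean : euclidean sigma.

Lemma euclideanDr (e u v : E) : sigma e (u + v) = sigma e u + sigma e v.
Proof.
by have := euclidean_linear E_euclidean e 1 u v; rewrite scale1r mul1r.
Qed.

Lemma euclidean0r (e : E) : sigma e 0 = 0.
Proof. by apply: (addrI (sigma e 0)); rewrite -euclideanDr !addr0. Qed.

Lemma euclideanZr (e : E) (a : R) (u : E) : sigma e (a *: u) = a * sigma e u.
Proof.
have := euclidean_linear E_euclidean e a u 0.
by rewrite /= addr0 euclidean0r addr0.
Qed.

Lemma sqr_normDZ (u v : E) (a : R) :
  `|u + a *: v| ^+ 2 = `|u| ^+ 2 + a * (2 * sigma u v + a * `|v| ^+ 2).
Proof.
rewrite !(euclidean_norm E_euclidean) euclideanDr euclideanZr.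
rewrite ![sigma (u + _) _](euclidean_sym E_euclidean) !euclideanDr !euclideanZr.
rewrite (euclidean_sym E_euclidean v u); ring.
Qed.

(** Polarization reduces the Cauchy-Schwarz inequality and the continuity of
the inner product to properties of the norm. *)
Lemma euclidean_polar (u v : E) :
  sigma u v = (`|u + v| ^+ 2 - `|u| ^+ 2 - `|v| ^+ 2) / 2.
Proof. by rewrite -[v in `|u + v|]scale1r sqr_normDZ; field. Qed.

Lemma euclidean_bound (u v : E) : `|sigma u v| <= `|u| * `|v|.
Proof.
have half (x : E) : sigma u x <= `|u| * `|x|.
  rewrite euclidean_polar ler_pdivrMr //.
  have := ler_normD u x; have := normr_ge0 (u + x).
  by have := normr_ge0 u; have := normr_ge0 x; nra.
rewrite ler_norml half andbT lerNl -mulN1r -euclideanZr scaleN1r.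
by rewrite -(normrN v).
Qed.

Lemma euclidean_cvg {T : Type} (F : set_system T) (FF : Filter F) (u : E)
    (f : T -> E) (l : E) :
  f @ F --> l -> (fun x => sigma u (f x)) @ F --> sigma u l.
Proof.
move=> fl; rewrite (_ : (fun x => _) = fun x : T =>
  (`|u + f x| * `|u + f x| - `|u| * `|u| - `|f x| * `|f x|) / 2); last first.
  by apply/funext => x; rewrite euclidean_polar !expr2.
rewrite euclidean_polar !expr2.
apply: cvgMl; apply: cvgB; first apply: cvgB.
- by apply: cvgM; apply: cvg_norm; apply: cvgD => //; exact: cvg_cst.
- exact: cvg_cst.
- by apply: cvgM; apply: cvg_norm.
Qed.

(** Writing [f] on the line as [f a + h *: q h], where the difference quotient
[q h] tends to [df], the difference quotient of the squared norm is
[2 * sigma (f a) (q h) + h * `|q h| ^+ 2], whose last term is negligible. *)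
Lemma is_derive_sqr_norm {V : normedModType R} {f : V -> E} {a v : V} {df : E} :
  is_derive a v f df ->
  is_derive a v (fun x => `|f x| ^+ 2) (2 * sigma (f a) df).
Proof.
move=> /is_derive_quotient fdf; apply: is_derive_cvg.
set q := fun h : R => _ in fdf.
have lim : (fun h : R => 2 * sigma (f a) (q h) + h * (`|q h| * `|q h|)) @ 0^'
    --> 2 * sigma (f a) df + 0 * (`|df| * `|df|).
  apply: cvgD; first by apply: cvgMr; exact: euclidean_cvg.
  apply: cvgM; first exact: cvg_within.
  by apply: cvgM; exact: cvg_norm.
rewrite mul0r addr0 in lim; apply: cvg_trans lim; apply: near_eq_cvg.
near=> h.
have h0 : h != 0 by near: h; exact: nbhs_dnbhs_neq.
have -> : f (h *: v + a) = f a + h *: q h.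
  by rewrite /q scalerA divff // scale1r [RHS]addrC subrK.
rewrite sqr_normDZ [_ + _ - _]addrAC subrr add0r.
by rewrite -expr2 [RHS]mulrA mulVf // mul1r.
Unshelve. all: by end_near. Qed.

End Euclidean.

(** * Evaluation along smooth families of maps *)

Lemma smooth_vec_differentiable {R : realType} {M : manifold R}
    {W : normedModType R} {f : M -> W} {c} {x : M} :
  smooth_vec f -> charts_at x c -> differentiable (f \o chart_inv c) (c x).
Proof. by move=> fC [ac cx]; case: (fC c ac 1) => + _; apply; exists x. Qed.

Section Family.
Context {R : realType} {M N : manifold R} {V : normedModType R}.
Context {A : set V} {phi : V -> smooth_map M N} {w : V}.
Hypotheses (A_open : open A) (phi_smooth : smooth_family A phi) (Aw : A w).

Lemma smooth_family_eval_continuous (t : M) :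
  {for w, continuous (fun z => phi z t)}.
Proof.
have AT_open : open (A `*` [set: M]).
  rewrite openE => -[z s] [/= Az _].
  exists (A, [set: M]); last by case.
  by split; [exact: open_nbhs_nbhs | exact: filterT].
have := family_continuous phi_smooth.
rewrite continuous_open_subspace // => /(_ (w, t)).
rewrite inE => /(_ (conj Aw I)) phi_cont.
apply: (cvg_comp (fun z => (z, t)) _ _ phi_cont).
by apply: cvg_pair => /=; [exact: cvg_id | exact: cvg_cst].
Qed.

(** Near [w] the map [z |-> f (phi z t)] is the composite of [f] read in a
chart [d] around [gamma t] and of the coordinates of [phi z t] in [d]; the
latter have derivative [v t] in the direction [u] by definition of the
velocity. *)
Lemma is_derive_smooth_family_eval {W : normedModType R} {f : N -> W}
    {gamma : smooth_map M N} {v : section_along gamma} {u : V} (t : M) :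
  smooth_vec f -> phi w = gamma -> velocity phi w u v ->
  is_derive w u (fun z => f (phi z t)) (tangent_map f (v t)).
Proof.
move=> f_smooth phiw phi_v; rewrite /tangent_map.
(* [d] is the chart that [tangent_map] selects at [gamma t]. *)
case: cid => d /= d_at.
have in_d : \forall z \near w, chart_dom d (phi z t).
  apply: (smooth_family_eval_continuous t).
  apply: open_nbhs_nbhs; split; first exact: chart_dom_open.
  by rewrite phiw; case: d_at.
apply: (@near_eq_is_derive _ _ _
    ((f \o chart_inv d) \o (fun z => d (phi z t)))).
  by near=> z; rewrite /= chart_mapK //; near: z.
have dw : d (phi w t) = d (gamma t) by rewrite phiw.
rewrite -dw; apply: is_derive_diff_comp (phi_v t d d_at) _.
by rewrite dw; exact: smooth_vec_differentiable.
Unshelve. all: by end_near. Qed.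

End Family.

(** * The differential of the least squares functional *)

Section LeastSquares.
Context {R : realType} {M N : manifold R} {E : normedModType R}.
Context {sigma : E -> E -> R} {j : N -> E} {k : nat}.
Context {theta : 'I_k -> M} {y : 'I_k -> N} {gamma : smooth_map M N}.
Hypotheses (E_euclidean : euclidean sigma) (j_smooth : smooth_vec j).

(** The covector [- k / 2] times the differential of the least squares
functional at [gamma]. *)
Definition residual_form (v : section_along gamma) : R :=
  \sum_(i < k)
    transpose sigma
      (fun v' : section_along gamma =>
         tangent_map j (eval_tangent (theta i) v'))
      (j (y i) - j (eval_map (theta i) gamma)) v.

Lemma tangent_map_linear (x : N) (a : R) (xi eta : tangent x) :
  tangent_map j (a *: xi + eta) = a *: tangent_map j xi + tangent_map j eta.
Proof. by rewrite /tangent_map -linearP. Qed.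

(** Continuity holds already for the seminorms of order zero over the points
[theta i]: by Cauchy-Schwarz each term is controlled by the operator norm of
the differential of [j] in a chart around [gamma (theta i)]. *)
Lemma residual_form_cotangent (b : R) :
  map_cotangent (fun v => b * residual_form v).
Proof.
split=> [a v w _ _|].
  rewrite mulrCA -mulrDr; congr (b * _).
  rewrite /residual_form mulr_sumr -big_split /=; apply: eq_bigr => i _.
  rewrite /transpose /eval_tangent tangent_map_linear.
  by rewrite (euclideanDr E_euclidean) (euclideanZr E_euclidean).
pose c i := sval (cid (atlas_cover (theta i))).
pose d i := sval (cid (atlas_cover (gamma (theta i)))).
have c_at i : charts_at (theta i) (c i) by rewrite /c; case: cid.
have d_at i : charts_at (gamma (theta i)) (d i) by rewrite /d; case: cid.
have bound i : exists2 C : R, 0 < C & forall xi : tangent (gamma (theta i)),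
    `|tangent_map j xi| <= C * `|tangent_coord xi (d i)|.
  have /diff_continuous /linear_lipschitz[C C0 Cj] :=
    smooth_vec_differentiable j_smooth (d_at i).
  by exists C => // xi; exact: Cj.
pose C i := s2val (cid2 (bound i)).
exists k, c, d, (fun i => [set theta i]), (fun=> [::]),
  (`|b| * \sum_(i < k) `|j (y i) - j (gamma (theta i))| * C i).
split=> [i|v _ B B0 vB].
  have [ac cx] := c_at i; have [ad dx] := d_at i.
  split=> //; first exact: compact_set1.
    by move=> _ ->.
  by move=> _ [_ -> <-].
rewrite normrM -mulrA ler_wpM2l // mulr_suml.
apply: le_trans (ler_norm_sum _ _ _) _; apply: ler_sum => i _.
apply: le_trans (euclidean_bound E_euclidean _ _) _.
rewrite -mulrA ler_wpM2l //; apply: le_trans (s2valP' (cid2 (bound i)) _) _.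
apply: ler_wpM2l; first exact: ltW (s2valP (cid2 (bound i))).
have := vB i (theta i) erefl.
by rewrite /= (chart_mapK (c_at i).2).
Qed.

Lemma least_squares_is_differential :
  is_differential (least_squares j theta y)
    (fun v => - (2 / k%:R) * residual_form v).
Proof.
split=> [|p A phi w u v A_open phi_smooth Aw phiw _ phi_v].
  exact: residual_form_cotangent.
have term i : is_derive w u (fun z => `|j (y i) - j (phi z (theta i))| ^+ 2)
    (2 * sigma (j (y i) - j (phi w (theta i)))
       (0 - tangent_map j (v (theta i)))).
  apply: (is_derive_sqr_norm E_euclidean).
  exact: (is_deriveB (is_derive_cst _ _ _)
    (is_derive_smooth_family_eval A_open phi_smooth Aw _ j_smooth phiw phi_v)).
rewrite (_ : least_squares j theta y \o phi = k%:R^-1 \*: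
    (\sum_(i < k) fun z => `|j (y i) - j (phi z (theta i))| ^+ 2)); last first.
  by apply/funext => z; rewrite /= fct_sumE.
apply: is_derive_eq (is_deriveZ k%:R^-1 (is_derive_sum term)) _.
rewrite /residual_form !scaler_sumr mulr_sumr; apply: eq_bigr => i _.
rewrite sub0r -[- tangent_map _ _]scaleN1r (euclideanZr E_euclidean) phiw /transpose.
rewrite /eval_tangent /eval_map; set s := sigma _ _.
by rewrite /GRing.scale /=; ring.
Qed.

End LeastSquares.

(** * Critical points on a submanifold of the space of maps *)

(** Every tangent vector of [Gamma] is the velocity of a local parametrization
whose image lies in [Gamma], so that [F] read in it has a minimum at an
interior point. *)
Lemma is_differential_conormal {R : realType} {M N : manifold R}
    {F : smooth_map M N -> R} {gamma : smooth_map M N}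
    {l : section_along gamma -> R} {p : nat} {Gamma : set (smooth_map M N)} :
  (forall g, Gamma g -> F gamma <= F g) -> is_differential F l ->
  submanifold_conormal p Gamma l.
Proof.
move=> gamma_min dF; split; first exact: differential_cotangent dF.
move=> v [v_tangent [A [phi [w [u [phiA Aw phiw phi_v]]]]]].
have A_open := param_open phiA.
have := differential_derive dF A_open (param_smooth phiA) Aw phiw v_tangent phi_v.
move=> /is_derive_local_min; apply.
(* The image of the whole parameter domain is a relatively open part of
   [Gamma]; in particular it is contained in [Gamma]. *)
have [U _ imA] := param_image_open phiA A_open (@subset_refl _ A).
near=> z; rewrite /= phiw; apply: gamma_min.
suff : (phi @` A) (phi z) by rewrite imA => -[].
exists z => //; near: z; exact: open_nbhs_nbhs.
Unshelve. all: by end_near. Qed.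

Theorem proposition3p1 (R : realType) (Theta Lambda : manifold R)
    (h : riemannian_metric Lambda)
    (E : normedModType R) (sigma : E -> E -> R) (E_euclidean : euclidean sigma)
    (j : Lambda -> E) (j_isometric : isometric_embedding h sigma j)
    (k : nat) (k_gt0 : (0 < k)%N)
    (theta : 'I_k -> Theta) (y : 'I_k -> Lambda)
    (p : nat) (Gamma : set (smooth_map Theta Lambda))
    (Gamma_submanifold : submanifold p Gamma) (Gamma_compact : compact Gamma)
    (gamma : smooth_map Theta Lambda) (Gamma_gamma : Gamma gamma)
    (gamma_min : forall g, Gamma g ->
       least_squares j theta y gamma <= least_squares j theta y g) :
  [/\ exists l, is_differential (least_squares j theta y) (gamma := gamma) l,
      forall l, is_differential (least_squares j theta y) (gamma := gamma) l ->
        submanifold_conormal p Gamma l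
    & forall v : section_along gamma, submanifold_tangent p Gamma v ->
        \sum_(i < k)
          transpose sigma
            (fun v' : section_along gamma =>
               tangent_map j (eval_tangent (theta i) v'))
            (j (y i) - j (eval_map (theta i) gamma)) v = 0].
Proof.
have ds := @least_squares_is_differential _ _ _ _ _ _ _ theta y gamma
  E_euclidean (embedding_smooth j_isometric).
have conormal l (dl : is_differential (least_squares j theta y) l) :=
  is_differential_conormal (p := p) gamma_min dl.
split; [by eexists; exact: ds | exact: conormal |].
move=> v /(conormal _ ds).2 /= /eqP; rewrite mulf_eq0 oppr_eq0 mulf_eq0 invr_eq0.
by rewrite !pnatr_eq0 (gtn_eqF k_gt0) => /eqP.
Qed.
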